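(* Fix integers $k\ge 2$ and $s\ge t\ge 2$. Then, as $n\to\infty$, \[ \operatorname{ex}^*_{k}(n,K_{s,t}) \le \left( \frac{k}{2}(s-t+1)^{1/t} (k-1)^{1-1/t} +o(1) \right) n^{2-1/t}. \]
   Context: All graphs are finite and simple. $K_{s,t}$ is the complete bipartite graph with sides of sizes $s$ and $t$; a copy of $K_{s,t}$ in a graph is a (not necessarily induced) subgraph isomorphic to it. Given a $k$-partite graph with specified parts, a copy of $K_{s,t}$ in it is called one-sided if its $s$-vertex side or its $t$-vertex side lies entirely in a single part. $\operatorname{ex}_k^*(n,K_{s,t})$ denotes the maximum number of edges in a $k$-partite graph with $n$ vertices in each part that contains no one-sided copy of $K_{s,t}$. The parameters $k,s,t$ are fixed and $o(1)$ denotes a quantity (depending on $k,s,t$) tending to $0$ as $n\to\infty$. *)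

(* Defs.v *)
From mathcomp Require Import all_boot.

Set Implicit Arguments.
Unset Strict Implicit.
Unset Printing Implicit Defensive.

(* A graph on V is given by its set E of edges, each a 2-element set of vertices. *)

Definition simple_graph (V : finType) (E : {set {set V}}) : bool :=
  [forall e in E, #|e| == 2].

Definition partite (V I : finType) (part : V -> I) (E : {set {set V}}) : bool :=
  [forall u, forall v, ([set u; v] \in E) ==> (part u != part v)].

(* A not necessarily induced copy of K_{s,t} is recorded by its two sides:
   S has s vertices, T has t vertices; edges of E inside S or T are allowed. *)
Definition is_Kst_copy (V : finType) (s t : nat) (E : {set {set V}})
    (S T : {set V}) : bool :=
  [&& #|S| == s, #|T| == t, [disjoint S & T] &
      [forall u in S, forall v in T, [set u; v] \in E]].

Definition in_single_part (V I : finType) (part : V -> I) (A : {set V}) : bool :=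
  [exists i, forall u in A, part u == i].

Definition has_one_sided_Kst (V I : finType) (part : V -> I) (s t : nat)
    (E : {set {set V}}) : bool :=
  [exists S : {set V}, exists T : {set V},
     is_Kst_copy s t E S T && (in_single_part part S || in_single_part part T)].

(* The vertex set is 'I_k * 'I_n, whose i-th part is the set of pairs (i, _).
   The edgeless graph is admissible when 0 < s and 0 < t, so the maximum is then
   over a nonempty family. *)
Definition ex_star (k n s t : nat) : nat :=
  \max_(E : {set {set 'I_k * 'I_n}}
        | [&& simple_graph E, partite fst E & ~~ has_one_sided_Kst fst s t E])
    #|E|.

(* Main.v *)
(** Consider the edges between a part [X] and the union [Y] of the other parts, put [j = t - 2], and for
   a [j]-subset [U] of [Y] let [D] be its common neighbourhood in [X].  A
   [t]-subset of [D] has at most [s - 1 - j = s - t + 1] common neighbours outside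
   [U], so the Kovari-Sos-Turan count bounds the edges between [D] and [Y \ U] by
   [c |D| + (t - 1) |Y|] with [c ^ t = (s - t + 1) |Y| ^ (t - 1)].  Summing over
   [U] gives, with [d x] the degree of [x] in [X],
     [sum_x C(d x, j) (d x - j - c) <= C(|Y|, j) (t - 1) |Y|].
   Since [C(d, j)] is monotone in [d], it may be replaced on the left by its value
   near [d = c + j], whence
     [sum_x d x <= |X| (c + j) + (t - 1) |Y| (|Y| / c) ^ j].
   The last term is of order [n ^ (2 - 2 / t)], and adding up over the parts
   counts every edge twice. *)
Require Import Defs.
From mathcomp Require Import all_boot all_order all_algebra.
From mathcomp Require Import all_classical all_reals all_analysis.
From mathcomp Require Import zify ring lra.

Set Implicit Arguments.
Unset Strict Implicit.
Unset Printing Implicit Defensive.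

Import Order.TTheory GRing.Theory Num.Theory.
Import numFieldNormedType.Exports.

(** * Power means, falling factorials and binomial ratios *)

Lemma rearrange_expn (m x y : nat) :
  x * y ^ m + y * x ^ m <= x * x ^ m + y * y ^ m.
Proof.
wlog xy : x y / x <= y => [H|].
  by case/orP: (leq_total x y) => /H; rewrite // addnC [leqRHS]addnC.
have h : x ^ m <= y ^ m by elim: m => // m IH; rewrite !expnS leq_mul.
nia.
Qed.

(** Power mean inequality, by induction from Chebyshev's sum inequality for the similarly ordered
    families [F] and [F ^ q]. *)
Lemma leq_sum_expn (I : finType) (A : {set I}) (m : nat) (F : I -> nat) :
  (\sum_(i in A) F i) ^ m.+1 <= #|A| ^ m * \sum_(i in A) F i ^ m.+1.
Proof.
have cheb q : (\sum_(i in A) F i) * (\sum_(i in A) F i ^ q) <=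
    #|A| * \sum_(i in A) F i ^ q.+1.
  (* Doubling symmetrizes the double sum, so that it can be compared pair by pair. *)
  rewrite -leq_double -!addnn big_distrlr /= -sum_nat_const.
  rewrite [X in X + _ <= _]exchange_big [X in _ <= X + _]exchange_big /=.
  rewrite -!big_split /=; apply: leq_sum => i _.
  rewrite -!big_split /=; apply: leq_sum => j _.
  by have := rearrange_expn q (F i) (F j); rewrite !expnS; lia.
elim: m => [|m IH]; first by rewrite mul1n.
rewrite expnS (leq_trans (leq_mul (leqnn _) IH)) // mulnCA expnSr -mulnA.
by rewrite leq_mul2l cheb orbT.
Qed.

(** Truncated subtraction covers [x <= t] as well, so small degrees need no separate case below. *)
Lemma expn_sub_leq_ffact (t x : nat) : (x - t) ^ t.+1 <= x ^_ t.+1.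
Proof.
rewrite ffact_prod -[X in _ ^ X]card_ord -prod_nat_const.
by apply: leq_prod => i _; rewrite leq_sub2l // -ltnS.
Qed.

Lemma ffact_leq_expn (t x : nat) : x ^_ t <= x ^ t.
Proof.
rewrite ffact_prod -[X in _ <= _ ^ X]card_ord -prod_nat_const.
by apply: leq_prod => i _; rewrite leq_subr.
Qed.

Lemma expn_leq_ffact (m j : nat) : m.+1 ^ j <= (m + j) ^_ j.
Proof.
rewrite ffact_prod -[X in _ ^ X]card_ord -prod_nat_const.
by apply: leq_prod => i _; have := ltn_ord i; lia.
Qed.

Lemma bin_ratio_leq (b m j : nat) : 'C(b, j) * m.+1 ^ j <= 'C(m + j, j) * b ^ j.
Proof.
rewrite -(@leq_pmul2r j`!) ?fact_gt0 // mulnAC bin_ffact [leqRHS]mulnAC bin_ffact.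
by rewrite mulnC leq_mul ?expn_leq_ffact ?ffact_leq_expn.
Qed.

(** * Double counting in a bipartite graph *)

Section Bipartite.
Variables (X Y : finType) (r : X -> Y -> bool).
Implicit Types (D T : {set X}) (B U : {set Y}).

Definition nbhd (x : X) : {set Y} := [set y | r x y].
Definition common_nbhd (U : {set Y}) : {set X} := [set x | U \subset nbhd x].

(** Kovari-Sos-Turan: after the power mean inequality, pairs of a [y] in [B] and a [t.+1]-subset of
    [D] inside its neighbourhood are counted in two ways. *)
Lemma expn_sum_link_leq (D : {set X}) (B : {set Y}) (t q : nat) :
  (forall T, T \subset D -> #|T| = t.+1 ->
     #|[set y in B | T \subset common_nbhd [set y]]| <= q) ->
  (\sum_(y in B) (#|D :&: common_nbhd [set y]| - t)) ^ t.+1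
    <= #|B| ^ t * (q * #|D| ^ t.+1).
Proof.
move=> hq; apply: leq_trans (leq_sum_expn _ _ _) _; rewrite leq_mul2l.
apply/orP; right.
apply: (@leq_trans (\sum_(y in B) #|D :&: common_nbhd [set y]| ^_ t.+1)).
  by apply: leq_sum => y _; apply: expn_sub_leq_ffact.
apply: leq_trans (_ : q * #|D| ^_ t.+1 <= _); last first.
  by rewrite leq_mul2l ffact_leq_expn orbT.
rewrite -bin_ffact mulnA; under eq_bigr do rewrite -bin_ffact.
rewrite -big_distrl leq_mul2r /=; apply/orP; right.
under eq_bigr => y _ do rewrite -cards_draws -sum1_card.
rewrite (exchange_big_dep [pred T | T \in [set A : {set X} | A \subset D & #|A| == t.+1]]) /=.
  rewrite -cards_draws mulnC -sum_nat_const; apply: leq_sum => T.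
  rewrite inE => /andP[sTD /eqP cT]; rewrite -(@leq_add2r 0) !addn0.
  apply: leq_trans (hq T sTD cT); rewrite -sum1_card.
  apply: eq_leq; apply: eq_bigl => y.
  by rewrite !inE finset.subsetI sTD cT eqxx /= andbT.
by move=> y T _; rewrite !inE finset.subsetI -andbA => /and3P[-> _ ->].
Qed.

(** Each [x] lies in the common neighbourhood of exactly those [U] that are [j]-subsets of
    [nbhd x]. *)
Lemma sum_common_nbhd (j : nat) (g : nat -> nat) :
  \sum_(U : {set Y} | #|U| == j) \sum_(x in common_nbhd U) g #|nbhd x|
    = \sum_x 'C(#|nbhd x|, j) * g #|nbhd x|.
Proof.
rewrite (exchange_big_dep predT) //=; apply: eq_bigr => x _.
rewrite sum_nat_const -cards_draws; congr (_ * _).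
by apply: eq_card => U; rewrite unfold_in !inE andbC.
Qed.

Lemma sum_link (U : {set Y}) :
  \sum_(y in ~: U) #|common_nbhd U :&: common_nbhd [set y]|
    = \sum_(x in common_nbhd U) (#|nbhd x| - #|U|).
Proof.
under eq_bigr => y _ do rewrite -sum1_card.
rewrite (exchange_big_dep [in common_nbhd U]) /=; last first.
  by move=> y x _; rewrite inE => /andP[].
apply: eq_bigr => x xU; have sU : U \subset nbhd x by move: xU; rewrite inE.
rewrite -cardsDS // sum1_card; apply: eq_card => y.
by rewrite unfold_in !inE sU finset.sub1set inE.
Qed.

End Bipartite.

(** * From the multipartite graph to its bipartite pieces *)

Lemma double_edges_leq (V : finType) (E : {set {set V}}) :
  simple_graph E ->
  (2 * #|E| <= \sum_(v : V) #|[set u | [set v; u] \in E]|)%N.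
Proof.
move=> /forallP hE.
have cE e : e \in E -> #|e| = 2 by move=> eE; have /implyP/(_ eE)/eqP := hE e.
rewrite mulnC -sum_nat_const -(eq_bigr _ cE).
under eq_bigr do rewrite -sum1_card.
rewrite (exchange_big_dep predT) //=; apply: leq_sum => v _; rewrite sum1_card.
rewrite -(card_in_imset (f := fun u => [set v; u])
  (D := [set u | [set v; u] \in E])); last first.
  move=> u w; rewrite !inE => uE wE uw.
  have : u \in [set v; w] by rewrite -uw set22.
  rewrite !inE => /orP[/eqP uv|/eqP //].
  by move: (cE _ uE); rewrite uv finset.setUid cards1.
apply/subset_leq_card/fintype.subsetP => e; rewrite unfold_in => /andP[eE ve].
have : #|e :\ v| == 1 by move: (cE _ eE); rewrite (cardsD1 v) ve add1n => -[->].
case/cards1P => u eu; apply/imsetP; exists u.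
  by rewrite inE -eu finset.setD1K.
by rewrite -eu finset.setD1K.
Qed.

(* [lift i] skips [i], so ['I_k * 'I_n] stands for the union of the parts other
   than the [i]-th. *)
Definition part_adj (k n : nat) (E : {set {set 'I_k.+1 * 'I_n}}) (i : 'I_k.+1)
    (w : 'I_n) (p : 'I_k * 'I_n) : bool :=
  [set (i, w); (lift i p.1, p.2)] \in E.

Lemma sum_deg_leq (k n : nat) (E : {set {set 'I_k.+1 * 'I_n}}) :
  partite fst E ->
  (\sum_v #|[set u | [set v; u] \in E]| <=
   \sum_(i : 'I_k.+1) \sum_(w : 'I_n)
     #|nbhd (part_adj E i) w|)%N.
Proof.
move=> hE; rewrite pair_big /=; apply: leq_sum => -[i w] _ /=.
rewrite -(card_imset (f := fun p : 'I_k * 'I_n => (lift i p.1, p.2))); last first.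
  by move=> [a b] [c d] /= /pair_equal_spec[/lift_inj -> ->].
apply/subset_leq_card/fintype.subsetP => -[i' w']; rewrite inE => uE.
have /forallP/(_ (i, w))/forallP/(_ (i', w'))/implyP/(_ uE) /= := hE.
case/unlift_some => a ia _.
by apply/imsetP; exists (a, w'); rewrite ?inE /part_adj /= -?ia.
Qed.

(** Otherwise [s] of these common neighbours and [T] form a copy whose [t]-vertex side lies in part
    [i]. *)
Lemma one_sided_common_nbhd (k n s t : nat) (E : {set {set 'I_k.+1 * 'I_n}})
    (i : 'I_k.+1) (T : {set 'I_n}) :
  ~~ has_one_sided_Kst fst s t E -> #|T| = t ->
  (#|[set y | T \subset common_nbhd
     (part_adj E i) [set y]]| < s)%N.
Proof.
move=> hE cT; rewrite ltnNge; apply: contra hE => hs.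
set f := fun p : 'I_k * 'I_n => (lift i p.1, p.2).
have [S0 sS cS] : exists2 S0 : {set 'I_k * 'I_n},
    S0 \subset [set y | T \subset common_nbhd (part_adj E i) [set y]] & #|S0| = s.
  case/card_geqP: hs => l [ul sl sub]; exists [set y in l];
    last by rewrite cardsE (card_uniqP ul).
  by apply/fintype.subsetP => y; rewrite inE => /sub.
have finj : injective f.
  by move=> [a b] [c d]; rewrite /f /= => /pair_equal_spec[/lift_inj -> ->].
apply/existsP; exists (f @: S0); apply/existsP; exists (pair i @: T).
apply/andP; split; last first.
  apply/orP; right; apply/existsP; exists i; apply/forallP => u.
  by apply/implyP => /imsetP[w _ ->].
apply/and4P; split.
- by rewrite card_imset // cS.
- by rewrite card_imset ?cT // => a b [].
- rewrite -setI_eq0; apply/eqP/finset.setP => u; rewrite !inE; apply/negbTE/negP.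
  case/andP => /imsetP[p _ ->] /imsetP[w _ [] /eqP].
  by rewrite eq_sym (negbTE (neq_lift _ _)).
apply/forallP => u; apply/implyP => /imsetP[p pS ->].
apply/forallP => v; apply/implyP => /imsetP[w wT ->].
move/fintype.subsetP: sS => /(_ p pS); rewrite inE => /fintype.subsetP/(_ w wT).
by rewrite inE finset.sub1set inE /part_adj finset.setUC.
Qed.

(** * Edge bounds with explicit parameters *)

Local Open Scope ring_scope.

(** Here [t = j + 2], and [q] stands for [s - t + 1]. Taking [c] and [z] as mere upper bounds, [z]
    for [|Y| / c], avoids roots and allows [c = 0]. *)
Lemma bipartite_edges_le (R : archiRealFieldType) (X Y : finType)
    (r : X -> Y -> bool) (j q : nat) (c z : R) :
  (forall T : {set X}, #|T| = j.+2 ->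
     (#|[set y | T \subset common_nbhd r [set y]]| <= q + j)%N) ->
  0 <= c -> 0 <= z ->
  q%:R * #|Y|%:R ^+ j.+1 <= c ^+ j.+2 -> #|Y|%:R <= z * c ->
  (\sum_x #|nbhd r x|)%:R <= #|X|%:R * (c + j%:R) + j.+1%:R * #|Y|%:R * z ^+ j.
Proof.
move=> hq c0 z0 hc hz.
(* [m + j] is the last integer degree not above [c + j]; [M] is the weight there. *)
set m := Num.trunc c; set M : R := 'C(m + j, j)%:R.
have /andP[mc cm] := truncn_itv c0; rewrite -/m in mc cm.
have M0 : 0 < M by rewrite ltr0n bin_gt0 leq_addl.
have link (U : {set Y}) : #|U| == j ->
    (\sum_(x in common_nbhd r U) (#|nbhd r x| - #|U|))%:R
      <= c * #|common_nbhd r U|%:R + j.+1%:R * #|Y|%:R.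
  move=> /eqP cU; rewrite -sum_link.
  set D := common_nbhd r U.
  have hT (T : {set X}) : T \subset D -> #|T| = j.+2 ->
      (#|[set y in ~: U | T \subset common_nbhd r [set y]]| <= q)%N.
    (* All [j] vertices of [U] are common neighbours of [T], which leaves at most [q] outside
       [U]. *)
    move=> sTD cT; rewrite -(leq_add2r j) -{1}cU -cardsUI.
    rewrite (_ : _ :&: U = finset.set0) ?cards0 ?addn0; last first.
      by apply/finset.setP => y; rewrite !inE; case: (y \in U); rewrite ?andbF.
    apply: leq_trans (hq T cT); apply/subset_leq_card/fintype.subsetP => y.
    rewrite !inE => /orP[/andP[]//|yU]; apply: fintype.subset_trans sTD _.
    apply/fintype.subsetP => x; rewrite !inE; apply: fintype.subset_trans.
    by rewrite finset.sub1set.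
  have := expn_sum_link_leq hT; set W := (\sum_(y in _) (_ - _))%N => hW.
  have WcD : W%:R <= c * #|D|%:R.
    rewrite -(@ler_pXn2r _ j.+2) ?nnegrE ?mulr_ge0 // -natrX.
    apply: le_trans (_ : (#|Y| ^ j.+1 * (q * #|D| ^ j.+2))%:R <= _).
      rewrite ler_nat (leq_trans hW) // leq_mul2r leq_exp2r //.
      by rewrite max_card orbT.
    rewrite natrM natrX natrM natrX mulrA exprMn (mulrC _ q%:R).
    by rewrite ler_wpM2r ?exprn_ge0.
  apply: le_trans (_ : (W + j.+1 * #|Y|)%:R <= _); last first.
    by rewrite natrD natrM lerD2r.
  (* Undoing the truncated subtraction in [W] costs at most [j.+1] for each [y]. *)
  rewrite ler_nat; apply: (@leq_trans (W + j.+1 * #|~: U|)); last first.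
    by rewrite leq_add2l leq_mul2l max_card orbT.
  rewrite mulnC -sum_nat_const -big_split /=; apply: leq_sum => y _.
  by rewrite addnC -leq_subLR.
have sumU : (\sum_x 'C(#|nbhd r x|, j) * (#|nbhd r x| - j))%:R
    <= c * (\sum_x 'C(#|nbhd r x|, j))%:R + 'C(#|Y|, j)%:R * (j.+1%:R * #|Y|%:R).
  rewrite -(sum_common_nbhd r j (fun d => (d - j)%N)).
  have -> : (\sum_x 'C(#|nbhd r x|, j) = \sum_x 'C(#|nbhd r x|, j) * 1)%N.
    by apply: eq_bigr => x _; rewrite muln1.
  rewrite -(sum_common_nbhd r j (fun=> 1%N)) -cardsT -cards_draws -sum1_card.
  rewrite !natr_sum mulr_sumr mulr_suml.
  rewrite [X in _ <= _ + X](eq_bigl (fun U : {set Y} => #|U| == j)); last first.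
    by move=> U; rewrite inE finset.subsetT.
  rewrite -big_split /=; apply: ler_sum => U cU.
  by rewrite mul1r sum1_card cardsT -{1}(eqP cU) link.
(* Both factors of [('C(d, j) - M) * (d - j - c)] change sign between [m + j] and
   [m + j + 1]. *)
have tangent x : M * (#|nbhd r x|%:R - (c + j%:R)) <=
    'C(#|nbhd r x|, j)%:R * ((#|nbhd r x| - j)%:R - c).
  set d := #|nbhd r x|.
  case: (ltnP d j) => [dj|jd].
    rewrite bin_small // mul0r mulr_ge0_le0 ?(ltW M0) // subr_le0.
    by rewrite (@le_trans _ _ j%:R) ?ler_nat ?(ltnW dj) // lerDr.
  rewrite natrB // (_ : d%:R - (c + j%:R) = d%:R - j%:R - c); last by ring.
  case: (leqP d (m + j)) => [dm|md].
    apply: ler_wnM2r; last by rewrite ler_nat leq_bin2l.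
    have : d%:R <= m%:R + j%:R :> R by rewrite -natrD ler_nat.
    lra.
  apply: ler_wpM2r; last by rewrite ler_nat leq_bin2l // ltnW.
  have : m.+1%:R + j%:R <= d%:R :> R by rewrite -natrD ler_nat.
  lra.
(* The ratio bound applies because [|Y| <= z * c <= z * (m + 1)]. *)
have binM : 'C(#|Y|, j)%:R <= M * z ^+ j.
  have m1 : 0 < m.+1%:R ^+ j :> R by rewrite exprn_gt0.
  rewrite -(ler_pM2r m1) -natrX -natrM.
  apply: le_trans (_ : ('C(m + j, j) * #|Y| ^ j)%:R <= _).
    by rewrite ler_nat bin_ratio_leq.
  rewrite natrM !natrX -mulrA -exprMn ler_wpM2l ?(ltW M0) // lerXn2r ?nnegrE //.
    by rewrite mulr_ge0.
  by rewrite (le_trans hz) // ler_wpM2l // ltW.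
rewrite -lerBlDl -(ler_pM2l M0).
apply: le_trans (_ : 'C(#|Y|, j)%:R * (j.+1%:R * #|Y|%:R) <= _); last first.
  by rewrite (mulrC (_ * _) (_ ^+ _)) [leRHS]mulrA ler_wpM2r ?mulr_ge0.
apply: le_trans (_ : \sum_x M * (#|nbhd r x|%:R - (c + j%:R)) <= _).
  by rewrite -mulr_sumr sumrB sumr_const natr_sum mulr_natl.
apply: le_trans (ler_sum _ (fun x _ => tangent x)) _.
under eq_bigr do rewrite mulrBr.
rewrite sumrB -mulr_suml -natr_sum lerBlDl mulrC (le_trans _ sumU) //.
by rewrite natr_sum; under [leRHS]eq_bigr do rewrite natrM.
Qed.

Lemma one_sided_free_edges_le (R : archiRealFieldType) (k n s j : nat) (c z : R)
    (E : {set {set 'I_k.+1 * 'I_n}}) :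
  simple_graph E -> partite fst E -> ~~ has_one_sided_Kst fst s j.+2 E ->
  (j.+2 <= s)%N -> 0 <= c -> 0 <= z ->
  (s - j.+1)%:R * (k * n)%:R ^+ j.+1 <= c ^+ j.+2 -> (k * n)%:R <= z * c ->
  2 * #|E|%:R <= k.+1%:R * (n%:R * (c + j%:R) + j.+1%:R * (k * n)%:R * z ^+ j).
Proof.
move=> sE pE fE js c0 z0 hc hz.
apply: le_trans (_ : (\sum_(i : 'I_k.+1) \sum_(w : 'I_n)
     #|nbhd (part_adj E i) w|)%:R <= _).
  by rewrite -natrM ler_nat (leq_trans (double_edges_leq sE)) ?sum_deg_leq.
have cY : #|{: 'I_k * 'I_n}| = (k * n)%N by rewrite card_prod !card_ord.
rewrite natr_sum mulr_natl -[X in _ *+ X]card_ord -sumr_const.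
apply: ler_sum => i _.
have := @bipartite_edges_le R _ _ (part_adj E i) j (s - j.+1) c z.
rewrite cY card_ord; apply=> // T cT.
rewrite -ltnS; apply: leq_trans (one_sided_common_nbhd i fE cT) _; lia.
Qed.

(** * Choice of parameters and asymptotics *)

Local Open Scope classical_set_scope.

Theorem proposition1p4 (R : realType) (k s t : nat)
    (hk : (2 <= k)%N) (ht : (2 <= t)%N) (hst : (t <= s)%N) :
  exists o : nat -> R,
    (o @ \oo --> (0 : R)) /\
    forall n : nat,
      (ex_star k n s t)%:R <=
        (k%:R / 2 * (s%:R - t%:R + 1) `^ (1 / t%:R)
           * (k%:R - 1) `^ (1 - 1 / t%:R) + o n)
        * n%:R `^ (2 - 1 / t%:R).
Proof.
case: k hk => // k' hk'; case: t ht hst => [|[|j]] // _ js.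
set a : R := 1 / j.+2%:R.
have a0 : 0 < a by rewrite divr_gt0 ?ltr0n.
have a1 : a <= 2^-1 by rewrite /a div1r lef_pV2 ?posrE ?ltr0n // ler_nat.
(* [K] collects the lower-order terms, all bounded by multiples of [n ^ (2 - 2 * a)], which is
   [n ^ (- a)] times the main order. *)
pose K : R := k'.+1%:R / 2 * (j%:R + j.+1%:R * k'%:R ^+ 2).
exists (fun n => K * n%:R^-1 `^ a); split.
  rewrite -(mulr0 K); apply: cvgMr.
  (* The shift makes every argument positive, as the right-hand limit at 0 requires. *)
  rewrite -(cvg_shiftS (fun n : nat => n%:R^-1 `^ a)) /=.
  apply: ((cvg_at_rightP (fun x => x `^ a) 0 0).1 (powR_cvg0 a0)); split.
    by move=> n; rewrite invr_gt0 ltr0n.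
  exact: cvg_harmonic.
move=> n; set b : R := (k' * n)%:R.
have b0 : 0 <= b by [].
set p : R := s%:R - j.+2%:R + 1.
have p_nat : p = (s - j.+1)%:R by rewrite /p natrB 1?ltnW // -[in RHS]natr1; ring.
have p1 : 1 <= p by rewrite p_nat ler1n subn_gt0.
have powa (x : R) : 0 <= x -> (x `^ a) ^+ j.+2 = x.
  by move=> x0; rewrite -powR_mulrn ?powR_ge0 // -powRrM /a divfK ?powRr1.
have b1a : b `^ a * b `^ (1 - a) = b.
  rewrite -powRD ?subrKC ?powRr1 //.
  by apply/implyP; rewrite oner_eq0.
(* The exact root of [c ^ t = p * b ^ (t - 1)]. Since [p >= 1], [z = b ^ a] satisfies
   [b <= z * c]. *)
pose c : R := p `^ a * b `^ (1 - a).
have c0 : 0 <= c by rewrite mulr_ge0 ?powR_ge0.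
have Ebound : (ex_star k'.+1 n s j.+2)%:R <=
   k'.+1%:R / 2 * (n%:R * (c + j%:R) + j.+1%:R * b * (b `^ a) ^+ j).
  rewrite /ex_star; elim/big_ind: _ => [|x y|E /and3P[sE pE fE]].
  - by rewrite mulr_ge0 ?addr_ge0 ?mulr_ge0 ?exprn_ge0 ?powR_ge0 ?invr_ge0 // addr_ge0.
  - by rewrite /maxn; case: ifP.
  rewrite mulrAC ler_pdivlMr // mulrC.
  apply: one_sided_free_edges_le fE _ c0 _ _ _ => //; rewrite ?powR_ge0 //.
    rewrite -p_nat /c exprMn powa ?(le_trans ler01) // ler_wpM2l ?(le_trans ler01) //.
    rewrite -!powR_mulrn ?powR_ge0 // -powRrM mulrBl mul1r /a divfK //.
    by rewrite -[j.+2%:R]natr1 addrK.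
  rewrite /c mulrCA b1a -[leLHS]mul1r ler_wpM2r //.
  apply: le_trans (_ : 1 `^ a <= _); first by rewrite powR1.
  by rewrite ge0_ler_powR ?nnegrE ?(le_trans ler01 p1) // ltW.
apply: le_trans Ebound _.
have -> : k'.+1%:R - 1 = k'%:R :> R by rewrite -natr1 addrK.
case: n => [|n'] in b b0 b1a c c0 *.
  rewrite powR0 ?mulr0; last by apply/eqP; lra.
  by rewrite /b muln0 mulr0 !mul0r addr0 mulr0.
set n := n'.+1; set N := n%:R `^ _; set L : R := n%:R `^ (2 - 2 * a).
have nL : n%:R^-1 `^ a * N = L.
  rewrite -powR_inv1 // -powRrM -powRD; last by rewrite pnatr_eq0 implybT.
  by congr (_ `^ _); ring.
have nc : n%:R * c = p `^ a * k'%:R `^ (1 - a) * N.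
  rewrite /c /b natrM powRM // -[X in X * _ = _]powRr1 // mulrCA -!mulrA.
  congr (_ * _); rewrite mulrCA -powRD; last by rewrite pnatr_eq0 implybT.
  by congr (_ * _ `^ _); ring.
have n_leL : n%:R <= L.
  rewrite -[leLHS]powRr1 // ler_powR ?ler1n //; lra.
(* With [j = t - 2] the exponent [1 + j * a] is [2 - 2 * a]; for the factor [k'] it is rounded up to
   2. *)
have bL : b * (b `^ a) ^+ j <= k'%:R ^+ 2 * L.
  have -> : b * (b `^ a) ^+ j = b `^ (2 - 2 * a).
    have b_n0 : b != 0 by rewrite pnatr_eq0 muln_eq0; case: (k') hk'.
    rewrite -powR_mulrn ?powR_ge0 // -powRrM -[X in X * _ = _]powRr1 // -powRD; last first.
      by rewrite b_n0 implybT.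
    congr (_ `^ _); rewrite (_ : j%:R = j.+2%:R - 2); last by rewrite -!natr1; ring.
    by rewrite mulrBr {1}/a div1r mulVf //; ring.
  rewrite /b natrM powRM // ler_wpM2r ?powR_ge0 // -powR_mulrn //.
  by rewrite ler_powR ?ler1n //; lra.
rewrite mulrDl -(mulrA K) nL (mulrDr n%:R) nc.
set z := (b `^ a) ^+ j in bL *; set u := p `^ a; set v := k'%:R `^ (1 - a).
(* This is exactly the difference of the two sides of the goal. *)
have : 0 <= k'.+1%:R / 2 * (j%:R * (L - n%:R) + j.+1%:R * (k'%:R ^+ 2 * L - b * z)).
  by rewrite mulr_ge0 // addr_ge0 // mulr_ge0 // subr_ge0.
rewrite /K; lra.
Qed.
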